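(* Let $\mathcal{H}$ be a complex Hilbert space with a dictionary $\mathcal{D}$, let $M>0$, and let $f\in\mathcal{H}(\mathcal{D},M)$, with a representation $f=\sum_{j=1}^\infty c_j\tilde\psi_j$, $\tilde\psi_j\in\mathcal{D}$, $\sum_{j=1}^\infty|c_j|\le M$. Let $(t_k)_{k\ge1}$ be a sequence with $t_k\in(0,1]$, and consider a realization $\psi^{(p)}_1,\psi^{(p)}_2,\dots\in\mathcal{D}$ of the weak pre-orthogonal greedy algorithm (WPre-OGA) applied to $f$ with parameters $(t_k)$, with remainders $f_1=f,f_2,f_3,\dots$. Put $$r_k=\sup_{j\ge1}\|\tilde\psi_j-P_{H_{k-1}}(\tilde\psi_j)\|,$$ where $H_{k-1}=\operatorname{span}\{\psi^{(p)}_1,\dots,\psi^{(p)}_{k-1}\}$ ($H_0=\{0\}$) and $P_{H_{k-1}}$ is the orthogonal projection onto $H_{k-1}$. Then for every $n\ge1$, $$\|f_n\|\le M\Bigl(1+\sum_{k=1}^{n-1}\Bigl(\frac{t_k}{r_k}\Bigr)^2\Bigr)^{-1/2}.$$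
   Context: A dictionary of $\mathcal{H}$ is a set $\mathcal{D}\subset\mathcal{H}$ with $\|\psi\|=1$ for all $\psi\in\mathcal{D}$ and $\overline{\operatorname{span}\mathcal{D}}=\mathcal{H}$. For $M>0$, $\mathcal{H}(\mathcal{D},M)$ is the set of $f\in\mathcal{H}$ for which there exist $\tilde\psi_j\in\mathcal{D}$ and $c_j\in\mathbb{C}$, $j=1,2,\dots$, with $f=\sum_{j=1}^\infty c_j\tilde\psi_j$ and $\sum_{j=1}^\infty|c_j|\le M$. WPre-OGA: a realization for $f$ with parameters $(t_k)$ is a sequence $\psi^{(p)}_1,\psi^{(p)}_2,\dots\in\mathcal{D}$ built as follows. Let $f_1=f$. At step $k\ge1$, given $H_{k-1}$ and $f_k$, for $\psi\in\mathcal{D}$ set $B_k^\psi=0$ if $\psi\in H_{k-1}$ and otherwise $$B_k^\psi=\frac{\psi-P_{H_{k-1}}(\psi)}{\|\psi-P_{H_{k-1}}(\psi)\|}$$ (the last vector of the Gram–Schmidt orthonormalization of $\psi^{(p)}_1,\dots,\psi^{(p)}_{k-1},\psi$). Choose $\psi^{(p)}_k\in\mathcal{D}$ such that $B_k:=B_k^{\psi^{(p)}_k}$ satisfies $$|\langle f_k,B_k\rangle|\ge t_k\sup\{|\langle f_k,B_k^\psi\rangle|:\psi\in\mathcal{D}\},$$ and put $f_{k+1}=f_k-\langle f_k,B_k\rangle B_k=f-\sum_{l=1}^{k}\langle f,B_l\rangle B_l$. (The existence of such selections is part of the hypothesis when $t_k=1$.) Convention: the algorithm is run only while the remainder is nonzero,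 i.e. the bound is asserted for those $n$ such that $f_k\ne0$ for all $k<n$; then $r_k>0$ for $k<n$. *)

(* Defs.v *)
From HB Require Import structures.
From mathcomp Require Import all_boot all_order all_algebra.
From mathcomp Require Import complex.
From mathcomp Require Import all_classical all_reals all_analysis.

Set Implicit Arguments.
Unset Strict Implicit.
Unset Printing Implicit Defensive.

Import Order.TTheory GRing.Theory Num.Theory.
Import numFieldNormedType.Exports.

Local Open Scope classical_set_scope.
Local Open Scope ring_scope.

(* The norm of a normed space over [R[i]] (and the modulus on [R[i]] itself)
   takes its values in [R[i]], where the order is partial. [rnorm] is the same
   nonnegative number as an element of [R], where suprema make sense. *)
Definition rnorm (R : realType) (V : normedZmodType R[i]) (x : V) : R :=
  complex.Re `|x|.

(* A complex Hilbert space is given by [H : completeNormedModType R[i]] and a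
   positive definite Hermitian form [ip : {dot H for Num.conj}] (linear in the
   first argument, conjugate-linear in the second) inducing the norm of [H]. *)
Definition induces_norm (R : realType) (H : completeNormedModType R[i])
    (ip : {dot H for Num.conj}) : Prop :=
  forall x : H, `|x| ^+ 2 = ip x x.

Definition linspan (K : numFieldType) (V : lmodType K) (A : set V) : set V :=
  [set x | exists (n : nat) (a : 'I_n -> K) (v : 'I_n -> V),
     (forall i, A (v i)) /\ x = \sum_(i < n) a i *: v i].

Definition dictionary (R : realType) (H : completeNormedModType R[i])
    (D : set H) : Prop :=
  (forall psi, D psi -> `|psi| = 1) /\ closure (linspan D) = [set: H].

(* Sequences are indexed from 0: [c j] and [u j] stand for the coefficient and
   the atom of index [j + 1]. The series of moduli is an extended real, equal
   to [+oo] when it diverges. *)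
Definition l1_representation (R : realType) (H : completeNormedModType R[i])
    (D : set H) (M : R) (f : H) (c : nat -> R[i]) (u : nat -> H) : Prop :=
  [/\ forall j, D (u j),
      series (fun j => c j *: u j) @ \oo --> f
    & (\sum_(0 <= j <oo) (rnorm (c j))%:E <= M%:E)%E].

Definition l1_class (R : realType) (H : completeNormedModType R[i])
    (D : set H) (M : R) : set H :=
  [set f | exists (c : nat -> R[i]) (u : nat -> H),
     l1_representation D M f c u].

(* The orthogonal projection onto the subspace [V]: the point [p] of [V] with
   [x - p] orthogonal to [V]. It is unique, and it exists whenever [V] is
   finite-dimensional (the value is unspecified if there is no such point). *)
Definition orthproj (R : realType) (H : completeNormedModType R[i])
    (ip : {dot H for Num.conj}) (V : set H) (x : H) : H :=
  get [set p | V p /\ forall v, V v -> ip (x - p) v = 0].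

Definition gs_vector (R : realType) (H : completeNormedModType R[i])
    (ip : {dot H for Num.conj}) (V : set H) (v : H) : H :=
  if v \in V then 0
  else `|v - orthproj ip V v|^-1 *: (v - orthproj ip V v).

(* The span of the first [k] selected vectors, [psi k] being the vector
   selected at step [k + 1]. *)
Definition selected_span (R : realType) (H : completeNormedModType R[i])
    (psi : nat -> H) (k : nat) : set H :=
  linspan [set psi j | j in [set j | (j < k)%N]].

(* [remainder ip f psi k] is the remainder before step [k + 1], i.e. f_{k+1}
   when remainders are numbered from f_1 = f. *)
Fixpoint remainder (R : realType) (H : completeNormedModType R[i])
    (ip : {dot H for Num.conj}) (f : H) (psi : nat -> H) (k : nat) : H :=
  if k is k'.+1 then
    let fk := remainder ip f psi k' in
    let B := gs_vector ip (selected_span psi k') (psi k') in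
    fk - ip fk B *: B
  else f.

(* Once the remainder is zero, the inequality below holds for any choice of
   [psi k] in [D], so a run that stops is a prefix of such sequences. *)
Definition WPreOGA_realization (R : realType) (H : completeNormedModType R[i])
    (ip : {dot H for Num.conj}) (D : set H) (t : nat -> R) (f : H)
    (psi : nat -> H) : Prop :=
  forall k : nat,
    let fk := remainder ip f psi k in
    let B := gs_vector ip (selected_span psi k) in
    D (psi k) /\
    t k * sup [set rnorm (ip fk (B v)) | v in D] <= rnorm (ip fk (B (psi k))).

Definition residual_radius (R : realType) (H : completeNormedModType R[i])
    (ip : {dot H for Num.conj}) (psi u : nat -> H) (k : nat) : R :=
  sup (range (fun j => rnorm (u j - orthproj ip (selected_span psi k) (u j)))).

(* Main.v *)
(** Since f_k is orthogonal to H_{k-1}, one has <f_k, u_j> = <f_k, u_j - P u_j>,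
    whose modulus is at most r_k S_k, where S_k is the supremum of the numbers
    |<f_k, B_k^v>|. Expanding f in ||f_k||^2 = <f_k, f> gives
    ||f_k||^2 <= M r_k S_k, while the choice of the atom gives
    ||f_{k+1}||^2 <= ||f_k||^2 - t_k^2 S_k^2. Hence x_k = ||f_k||^2 / M^2
    satisfies x_{k+1} <= x_k (1 - x_k (t_k / r_k)^2), so that 1 / x_k grows by at
    least (t_k / r_k)^2 at each step, starting from 1 / x_1 >= 1. *)

Require Import Defs.
From HB Require Import structures.
From mathcomp Require Import all_boot all_order all_algebra.
From mathcomp Require Import complex.
From mathcomp Require Import all_classical all_reals all_analysis.
From mathcomp Require Import ring.

Import Order.TTheory GRing.Theory Num.Theory.
Import numFieldNormedType.Exports.

Local Open Scope classical_set_scope.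
Local Open Scope ring_scope.

Set Implicit Arguments.
Unset Strict Implicit.
Unset Printing Implicit Defensive.

(** * Closure properties of linear spans *)

Section LinearSpan.
Variables (K : numFieldType) (V : lmodType K).
Implicit Types (A W : set V) (x y : V) (a : K).

Lemma mem_linspan A x : A x -> linspan A x.
Proof.
move=> Ax; exists 1%N, (fun=> 1), (fun=> x).
by rewrite big_ord1 scale1r.
Qed.

Lemma linspan0 A : linspan A 0.
Proof.
by exists 0%N, (fun=> 0), (fun=> 0); split=> [[]//|]; rewrite big_ord0.
Qed.

Lemma linspanP A a x y : linspan A x -> linspan A y -> linspan A (a *: x + y).
Proof.
move=> [m [b [v [Av ->]]]] [n [d [w [Aw ->]]]].
exists (m + n)%N.
exists (fun i => match fintype.split i with inl j => a * b j | inr j => d j end).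
exists (fun i => match fintype.split i with inl j => v j | inr j => w j end).
split=> [i|]; first by case: (fintype.split i).
rewrite big_split_ord scaler_sumr; congr (_ + _); apply: eq_bigr => i _.
  by rewrite (unsplitK (inl i)) scalerA.
by rewrite (unsplitK (inr i)).
Qed.

Lemma linspanB A x y : linspan A x -> linspan A y -> linspan A (x - y).
Proof. by move=> Ax Ay; rewrite addrC -scaleN1r; apply: linspanP. Qed.

Lemma linspanZ A a x : linspan A x -> linspan A (a *: x).
Proof.
by move=> Ax; rewrite -[_ *: _]addr0; apply: linspanP => //; exact: linspan0.
Qed.

Lemma linspan_min A W : W 0 ->
  (forall a x y, W x -> W y -> W (a *: x + y)) ->
  A `<=` W -> linspan A `<=` W.
Proof.
move=> W0 Wlin AW _ [n [a [v [Av ->]]]].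
elim/big_rec: _ => // i x _ Wx; apply: Wlin => //; exact: AW.
Qed.

End LinearSpan.

(** * Real-valued norms and moduli *)

Section RealNorm.
Variable R : realType.
Implicit Types V : normedZmodType R[i].

Lemma rnormE V (x : V) : (rnorm x)%:C%C = `|x|.
Proof. by rewrite RRe_real ?normr_real. Qed.

Lemma rnorm_ge0 V (x : V) : 0 <= rnorm x.
Proof. by rewrite -ler0c rnormE. Qed.

Lemma rnorm0 V : rnorm (0 : V) = 0.
Proof. by rewrite /rnorm normr0. Qed.

Lemma rnorm_eq0 V (x : V) : (rnorm x == 0) = (x == 0).
Proof. by rewrite -(inj_eq (@complexI _)) rnormE normr_eq0. Qed.

Lemma ler_rnormD V (x y : V) : rnorm (x + y) <= rnorm x + rnorm y.
Proof. by rewrite -lecR rmorphD/= !rnormE ler_normD. Qed.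

Lemma rnormM (x y : R[i]) : rnorm (x * y) = rnorm x * rnorm y.
Proof. by apply: complexI; rewrite rmorphM/= !rnormE normrM. Qed.

Lemma rnormZ (V : normedModType R[i]) a (x : V) :
  rnorm (a *: x) = rnorm a * rnorm x.
Proof. by apply: complexI; rewrite rmorphM/= !rnormE normrZ. Qed.

Lemma cvg_rnorm_sub_lt (V : normedModType R[i]) (x : nat -> V) (l : V) (e : R) :
  x @ \oo --> l -> 0 < e -> exists n, rnorm (l - x n) < e.
Proof.
move=> /cvgrPdist_lt xl e0.
have [|N _ /(_ N (leqnn N)) lN] := xl e%:C%C; first by rewrite ltcR.
by exists N; rewrite -ltcR rnormE.
Qed.

End RealNorm.

(** * Inner products, orthogonal projections and Gram-Schmidt vectors *)

Section InnerProduct.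
Variables (R : realType) (H : completeNormedModType R[i]).
Variable ip : {dot H for Num.conj}.
Hypothesis ip_norm : induces_norm ip.
Implicit Types (x y b : H) (V : set H).

Lemma ipDr x y z : ip x (y + z) = ip x y + ip x z.
Proof. exact: linearDr. Qed.

Lemma ipBl x y z : ip (x - y) z = ip x z - ip y z.
Proof. exact: linearBl. Qed.

Lemma ip0l x : ip 0 x = 0.
Proof. exact: linear0l. Qed.

Lemma ip0r x : ip x 0 = 0.
Proof. exact: linear0r. Qed.

Lemma ipZl a x y : ip (a *: x) y = a * ip x y.
Proof. exact: linearZl_LR. Qed.

Lemma ipZr a x y : ip x (a *: y) = a^* * ip x y.
Proof. exact: linearZr_LR. Qed.

Lemma ip_rnorm x : ip x x = (rnorm x ^+ 2)%:C%C.
Proof. by rewrite -ip_norm -rnormE rmorphXn. Qed.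

Lemma rnorm_ip_self x : rnorm (ip x x) = rnorm x ^+ 2.
Proof. by rewrite ip_rnorm /rnorm ger0_norm// ler0c sqr_ge0. Qed.

Lemma rnorm_pythagoras x y :
  ip x y = 0 -> rnorm (x + y) ^+ 2 = rnorm x ^+ 2 + rnorm y ^+ 2.
Proof.
move=> xy; apply: complexI; rewrite rmorphD/= -!ip_rnorm.
exact: hnormDd.
Qed.

(** The alternative [b = 0] is kept because [gs_vector] returns 0 on [V]; a step of the algorithm
    may then leave the remainder unchanged. *)
Lemma ip_sub_proj_line x b : b = 0 \/ rnorm b = 1 ->
  ip (x - ip x b *: b) b = 0.
Proof.
rewrite ipBl ipZl ip_rnorm => -[->|->].
  by rewrite ip0r !mul0r subr0.
by rewrite expr1n mulr1 subrr.
Qed.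

Lemma rnorm_sub_proj_line x b : b = 0 \/ rnorm b = 1 ->
  rnorm (x - ip x b *: b) ^+ 2 = rnorm x ^+ 2 - rnorm (ip x b) ^+ 2.
Proof.
move=> b01; have := @rnorm_pythagoras (x - ip x b *: b) (ip x b *: b).
rewrite ipZr ip_sub_proj_line// mulr0 subrK rnormZ => /(_ erefl) ->.
case: b01 => ->; last by rewrite mulr1 addrK.
by rewrite ip0r !rnorm0 mul0r addrK.
Qed.

Lemma rnorm_ip_unit_le x b : b = 0 \/ rnorm b = 1 -> rnorm (ip x b) <= rnorm x.
Proof.
move=> /(rnorm_sub_proj_line x) e.
by rewrite -ler_sqr ?nnegrE ?rnorm_ge0// -subr_ge0 -e sqr_ge0.
Qed.

Lemma rnorm_normalize x : rnorm (`|x|^-1 *: x) = (x != 0)%:R.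
Proof.
have [->|x0] := eqVneq x 0; first by rewrite scaler0 rnorm0.
by apply: complexI; rewrite rnormE normrZ normfV normr_id mulVf ?normr_eq0.
Qed.

(** Cauchy-Schwarz, reduced to a unit vector by normalizing [y]. *)
Lemma rnorm_ip_le x y : rnorm (ip x y) <= rnorm x * rnorm y.
Proof.
have [->|y0] := eqVneq y 0; first by rewrite ip0r !rnorm0 mulr0.
pose e := `|y|^-1 *: y.
have ye : y = `|y| *: e by rewrite scalerA mulfV ?scale1r ?normr_eq0.
have e1 : e = 0 \/ rnorm e = 1 by right; rewrite rnorm_normalize y0.
rewrite {1}ye ipZr rnormM {1}/rnorm norm_conjC normr_id mulrC.
by rewrite ler_wpM2r ?rnorm_ge0 ?rnorm_ip_unit_le.
Qed.

(** Separates the existence of projections from [orthproj], whose value is arbitrary without it. For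
    the selected spans it is obtained later by Gram-Schmidt induction. *)
Definition has_proj V :=
  forall x, exists p, V p /\ forall v, V v -> ip (x - p) v = 0.

Lemma orthprojP V x : has_proj V ->
  V (orthproj ip V x) /\ forall v, V v -> ip (x - orthproj ip V x) v = 0.
Proof. by move=> /(_ x)/getPex. Qed.

Lemma rnorm_sub_orthproj_le V x : has_proj V ->
  rnorm (x - orthproj ip V x) <= rnorm x.
Proof.
move=> /(@orthprojP _ x)[Vp ort]; rewrite -ler_sqr ?nnegrE ?rnorm_ge0//.
rewrite -[in leRHS](subrK (orthproj ip V x) x).
by rewrite [leRHS]rnorm_pythagoras ?ort// lerDl sqr_ge0.
Qed.

Lemma gs_vector_dichotomy V x :
  gs_vector ip V x = 0 \/ rnorm (gs_vector ip V x) = 1.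
Proof.
rewrite /gs_vector; case: ifP => _; first by left.
(* Off [V] the residual can still vanish when [orthproj] is an arbitrary value; its normalization is
   then 0. *)
rewrite rnorm_normalize; have [->|] := eqVneq; last by right.
by rewrite scaler0; left.
Qed.

Lemma gs_vector_orth V x v : has_proj V -> V v -> ip (gs_vector ip V x) v = 0.
Proof.
move=> /(@orthprojP _ x)[Vp ort] Vv; rewrite /gs_vector; case: ifP => _.
  by rewrite ip0l.
by rewrite ipZl ort ?mulr0.
Qed.

Lemma gs_vectorE V x : has_proj V -> x \notin V ->
  x = orthproj ip V x + `|x - orthproj ip V x| *: gs_vector ip V x.
Proof.
move=> /(@orthprojP _ x)[Vp _] Vx; rewrite /gs_vector (negbTE Vx) scalerA.
have [e|ne] := eqVneq (x - orthproj ip V x) 0.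
  by case/negP: Vx; rewrite inE -[x](subrK (orthproj ip V x)) e add0r.
by rewrite mulfV ?normr_eq0// scale1r addrC subrK.
Qed.

(* The definition takes [B = 0] on [V], where [x - P x = 0]. *)
Lemma rnorm_ip_orth V g x : has_proj V -> (forall v, V v -> ip g v = 0) ->
  rnorm (ip g x) = rnorm (x - orthproj ip V x) * rnorm (ip g (gs_vector ip V x)).
Proof.
move=> VP gV; have [Vx|Vx] := boolP (x \in V).
  by rewrite /gs_vector Vx (gV _ (set_mem Vx)) ip0r !rnorm0 mulr0.
rewrite {1}(gs_vectorE VP Vx) ipDr gV ?add0r; last by have [] := orthprojP x VP.
by rewrite ipZr rnormM {1}/rnorm norm_conjC normr_id.
Qed.

End InnerProduct.

(** * Estimates from an absolutely summable representation *)

Section RepresentationBound.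
Variables (R : realType) (H : completeNormedModType R[i]).
Variable ip : {dot H for Num.conj}.
Hypothesis ip_norm : induces_norm ip.
Variables (D : set H) (M : R) (f : H) (c : nat -> R[i]) (u : nat -> H).
Hypothesis f_repr : l1_representation D M f c u.

(** The triangle inequality bounds each partial sum by [C] times a partial sum of the moduli, hence
    by [M * C]; Cauchy-Schwarz carries this to the limit [f]. *)
Lemma l1_representation_ip_le g (C : R) :
  0 <= C -> (forall j, rnorm (ip g (u j)) <= C) -> rnorm (ip g f) <= M * C.
Proof.
move=> C0 uC; have [_ cvg_f sum_c] := f_repr.
have partial N : rnorm (ip g (series (fun j => c j *: u j) N)) <= M * C.
  have cM : \sum_(0 <= j < N) rnorm (c j) <= M.
    rewrite -lee_fin (le_trans _ sum_c)// -sumEFin.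
    by apply: nneseries_lim_ge => j _ _; rewrite lee_fin rnorm_ge0.
  apply: le_trans (ler_wpM2r C0 cM); rewrite /series/= big_distrl/=.
  elim/big_rec2: _ => [|j a x _ xa]; first by rewrite ip0r rnorm0.
  rewrite ipDr (le_trans (ler_rnormD _ _))// lerD//.
  by rewrite ipZr rnormM {1}/rnorm norm_conjC (ler_wpM2l (rnorm_ge0 (c j))).
apply/ler_addgt0Pr => e e0.
(* Adding 1 keeps the divisor of [e] positive when [g = 0]. *)
have g1 : 0 < rnorm g + 1 by rewrite ltr_wpDl ?rnorm_ge0.
have [N fN] := cvg_rnorm_sub_lt cvg_f (divr_gt0 e0 g1).
rewrite -(subrK (series (fun j => c j *: u j) N) f) ipDr.
rewrite (le_trans (ler_rnormD _ _))// addrC lerD//.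
rewrite (le_trans (rnorm_ip_le ip_norm _ _))//.
rewrite (le_trans (ler_wpM2l (rnorm_ge0 _) (ltW fN)))//.
by rewrite mulrCA ler_piMr ?(ltW e0)// ler_pdivrMr// mul1r lerDl.
Qed.

(** Taking [g = f] and [C = rnorm f] in the previous bound gives [rnorm f ^+ 2 <= M * rnorm f]. *)
Lemma l1_representation_rnorm_le : dictionary D -> rnorm f <= M.
Proof.
move=> [D1 _]; have [Du _ _] := f_repr.
have [->|f0] := eqVneq f 0.
  (* For [f = 0] the claim is [0 <= M], which is the bound at [g = 0], [C = 1]. *)
  have := @l1_representation_ip_le 0 1 ler01.
  by rewrite ip0l !rnorm0 mulr1; apply=> j; rewrite ip0l rnorm0.
have := @l1_representation_ip_le f _ (rnorm_ge0 f).
have f_gt0 : 0 < rnorm f by rewrite lt_def rnorm_eq0 f0 rnorm_ge0.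
rewrite (rnorm_ip_self ip_norm) expr2.
rewrite ler_pM2r//; apply=> j; apply: (rnorm_ip_unit_le ip_norm); right.
by apply: complexI; rewrite rnormE D1.
Qed.

End RepresentationBound.

(** * Selected spans and remainders of the algorithm *)

Section SelectedSpan.
Variables (R : realType) (H : completeNormedModType R[i]).
Variable ip : {dot H for Num.conj}.
Hypothesis ip_norm : induces_norm ip.
Variable psi : nat -> H.
Local Notation V := (selected_span psi).
Local Notation B k := (gs_vector ip (V k) (psi k)).

Lemma selected_span0 v : V 0 v -> v = 0.
Proof.
apply: (@linspan_min _ _ _ [set 0]) => //= [a x y -> ->|_ [j//]].
by rewrite scaler0 addr0.
Qed.

Lemma sub_selected_spanS k : V k `<=` V k.+1.
Proof.
apply: linspan_min => [|a x y|_ [j jk <-]]; [exact: linspan0|exact: linspanP|].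
by apply: mem_linspan; exists j => //=; exact: ltnW.
Qed.

Lemma mem_selected_spanS k : V k.+1 (psi k).
Proof. by apply: mem_linspan; exists k => /=. Qed.

Lemma selected_spanSP k v :
  V k.+1 v -> exists a, exists2 y, V k y & v = a *: psi k + y.
Proof.
move: v; apply: linspan_min.
- by exists 0, 0; [exact: linspan0|rewrite scale0r addr0].
- move=> a _ _ [b [x Vx ->]] [d [y Vy ->]].
  exists (a * b + d), (a *: x + y); first exact: linspanP.
  by rewrite scalerDl scalerDr scalerA addrACA.
- move=> _ [j /= + <-]; rewrite ltnS leq_eqVlt => /orP[/eqP ->|jk].
    by exists 1, 0; [exact: linspan0|rewrite scale1r addr0].
  exists 0, (psi j); last by rewrite scale0r add0r.
  by apply: mem_linspan; exists j.
Qed.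

Lemma gs_vector_selected_span k : has_proj ip (V k) -> V k.+1 (B k).
Proof.
move=> /(@orthprojP _ _ _ _ (psi k))[Vp _]; rewrite /gs_vector; case: ifP => _.
  exact: linspan0.
apply/linspanZ/linspanB; first exact: mem_selected_spanS.
exact: sub_selected_spanS.
Qed.

(** Both [g] and [B k] are orthogonal to [V k], so the difference is too. Its product with [psi k]
    then has modulus proportional to that of its product with [B k], which is 0. *)
Lemma gram_schmidt_step_orth k g : has_proj ip (V k) ->
  (forall v, V k v -> ip g v = 0) ->
  forall v, V k.+1 v -> ip (g - ip g (B k) *: B k) v = 0.
Proof.
move=> VP gV.
have gV' v : V k v -> ip (g - ip g (B k) *: B k) v = 0.
  by move=> Vv; rewrite ipBl ipZl gV// (gs_vector_orth _ VP)// mulr0 subr0.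
move=> _ /selected_spanSP[a [y Vy ->]].
rewrite ipDr (gV' _ Vy) addr0 ipZr; apply/eqP; rewrite mulf_eq0.
rewrite -(rnorm_eq0 (ip _ _)).
rewrite (rnorm_ip_orth _ VP gV') (ip_sub_proj_line ip_norm).
  by rewrite rnorm0 mulr0 eqxx orbT.
exact: gs_vector_dichotomy.
Qed.

(** If [p] is the projection of [x] onto [V k], adding the component of [x - p] along [B k] projects
    onto [V k.+1]: the residual is one Gram-Schmidt step applied to [x - p]. *)
Lemma has_proj_selected_span k : has_proj ip (V k).
Proof.
elim: k => [|k VP] x.
  exists 0; split; first exact: linspan0.
  by move=> v /selected_span0 ->; rewrite ip0r.
have [Vp ort] := orthprojP x VP; set p := orthproj _ _ _ in Vp ort.
exists (ip (x - p) (B k) *: B k + p); split.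
  by apply: linspanP; [exact: gs_vector_selected_span|exact: sub_selected_spanS].
by rewrite opprD addrCA addrC; exact: gram_schmidt_step_orth.
Qed.

Variable f : H.
Local Notation rem := (remainder ip f psi).

Lemma remainder_orth k v : V k v -> ip (rem k) v = 0.
Proof.
elim: k v => [v /selected_span0 ->|k IH]; first by rewrite ip0r.
exact: gram_schmidt_step_orth (has_proj_selected_span k) IH.
Qed.

Lemma sub_remainder_selected_span k : V k (f - rem k).
Proof.
elim: k => [|k IH] /=; first by rewrite subrr; exact: linspan0.
rewrite opprB addrCA; apply: linspanP; last exact: sub_selected_spanS.
by apply: gs_vector_selected_span; exact: has_proj_selected_span.
Qed.

Lemma ip_remainder k : ip (rem k) f = ip (rem k) (rem k).
Proof.
have := ipDr ip (rem k) (f - rem k) (rem k).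
by rewrite subrK (remainder_orth (sub_remainder_selected_span k)) add0r.
Qed.

Lemma rnorm_remainderS k :
  rnorm (rem k.+1) ^+ 2 = rnorm (rem k) ^+ 2 - rnorm (ip (rem k) (B k)) ^+ 2.
Proof. by rewrite /= rnorm_sub_proj_line//; exact: gs_vector_dichotomy. Qed.

(** [sup] bounds its set only if the set is bounded above; here [rnorm (rem k)] is a bound. *)
Lemma gs_vector_ip_le_sup (D : set H) k v : D v ->
  rnorm (ip (rem k) (gs_vector ip (V k) v)) <=
  sup [set rnorm (ip (rem k) (gs_vector ip (V k) w)) | w in D].
Proof.
move=> Dv; apply: ub_le_sup; last by exists v.
exists (rnorm (rem k)) => _ [w _ <-]; apply: (rnorm_ip_unit_le ip_norm).
exact: gs_vector_dichotomy.
Qed.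

Variables (D : set H) (M : R) (c : nat -> R[i]) (u : nat -> H).
Hypothesis D_dict : dictionary D.
Hypothesis f_repr : l1_representation D M f c u.

Lemma le_residual_radius k j :
  rnorm (u j - orthproj ip (V k) (u j)) <= residual_radius ip psi u k.
Proof.
apply: ub_le_sup; last by exists j.
(* Atoms have norm 1, and subtracting the projection does not increase the norm. *)
exists 1 => _ [i _ <-].
have [[D1 _] [Du _ _]] := (D_dict, f_repr).
rewrite (le_trans (rnorm_sub_orthproj_le ip_norm _ (has_proj_selected_span k)))//.
by rewrite -lecR rnormE D1.
Qed.

Lemma rnorm_remainder_le k :
  rnorm (rem k) ^+ 2 <= M * (residual_radius ip psi u k *
    sup [set rnorm (ip (rem k) (gs_vector ip (V k) v)) | v in D]).
Proof.
rewrite -(rnorm_ip_self ip_norm) -ip_remainder.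
have [Du _ _] := f_repr.
have bound j : rnorm (ip (rem k) (u j)) <= residual_radius ip psi u k *
    sup [set rnorm (ip (rem k) (gs_vector ip (V k) v)) | v in D].
  rewrite (rnorm_ip_orth _ (has_proj_selected_span k)) => [|v Vv].
    rewrite ler_pM ?rnorm_ge0 ?le_residual_radius//.
    exact: gs_vector_ip_le_sup.
  exact: remainder_orth.
apply: (l1_representation_ip_le ip_norm f_repr) => //.
by apply: le_trans (bound 0%N); exact: rnorm_ge0.
Qed.

End SelectedSpan.

(** [A] and [A'] stand for successive squared remainder norms, [s] for the supremum and [w] for the
    accumulated weight. With [x = A / M ^+ 2] and [q = (t / r) ^+ 2], the claim reduces to
    [(1 + x * q) * (1 - x * q) <= 1]. Products replace reciprocals, so [A = 0] is allowed. *)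
Lemma greedy_recursion_step (R : realFieldType) (M A A' w r s t : R) :
  0 < M -> 0 <= A' -> 0 <= w -> A' <= A - (t * s) ^+ 2 -> A <= M * (r * s) ->
  0 <= A -> 0 <= t -> 0 <= s -> 0 <= r ->
  A * w <= M ^+ 2 -> A' * (w + (t / r) ^+ 2) <= M ^+ 2.
Proof.
move=> M0 A'0 w0 A'le Ale A0 t0 s0 r0 Aw.
set q := (t / r) ^+ 2; have q0 : 0 <= q by exact: sqr_ge0.
have M20 : 0 < M ^+ 2 by exact: exprn_gt0.
have [x x0 AE] : exists2 x, 0 <= x & A = x * M ^+ 2.
  by exists (A / M ^+ 2); rewrite ?divr_ge0 ?divfK ?gt_eqF ?(ltW M20).
have xw : x * w <= 1 by rewrite -(ler_pM2r M20) mul1r mulrAC -AE.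
have xqs : x * M ^+ 2 * (x * q) <= (t * s) ^+ 2.
  (* The inverse of 0 is 0, so [r = 0] gives [q = 0]. *)
  rewrite /q; have [->|r_neq0] := eqVneq r 0.
    by rewrite invr0 mulr0 expr0n/= !mulr0 sqr_ge0.
  have -> : x * M ^+ 2 * (x * (t / r) ^+ 2) = (x * M * (t / r)) ^+ 2 by ring.
  have rp : 0 < r by rewrite lt_def r_neq0.
  have rV0 : 0 <= r^-1 by rewrite invr_ge0.
  (* This is [A <= M * (r * s)] divided by [M * r]. *)
  have le_s : x * M / r <= s.
    rewrite ler_pdivrMr// -(ler_pM2l M0) mulrC -mulrA -expr2 -AE.
    by rewrite [s * r]mulrC.
  have -> : x * M * (t / r) = t * (x * M / r) by rewrite mulrCA mulrA.
  rewrite ler_sqr ?nnegrE ?mulr_ge0 ?(ltW M0)//.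
  exact: ler_wpM2l.
have A'x : A' <= M ^+ 2 * (x * (1 - x * q)).
  rewrite (le_trans A'le)// AE.
  suff -> : M ^+ 2 * (x * (1 - x * q)) = x * M ^+ 2 - x * M ^+ 2 * (x * q).
    by rewrite lerD2l lerN2.
  by ring.
(* Nonnegativity of [A'] yields [0 <= 1 - x * q] once [x] is positive, which allows multiplying
   [x * w <= 1] by that factor. *)
have y0 : 0 <= x * (1 - x * q) by rewrite -(pmulr_rge0 _ M20) (le_trans A'0).
rewrite (le_trans (ler_wpM2r (addr_ge0 w0 q0) A'x))// -mulrA ler_piMr ?(ltW M20)//.
have [xe|xn] := eqVneq x 0; first by rewrite xe !mul0r.
have xp : 0 < x by rewrite lt_def xn.
rewrite pmulr_rge0// in y0.
have -> : x * (1 - x * q) * (w + q) = (x * w + x * q) * (1 - x * q) by ring.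
rewrite (le_trans (y := (1 + x * q) * (1 - x * q)))//.
  by rewrite ler_wpM2r// lerD2r.
have -> : (1 + x * q) * (1 - x * q) = 1 - (x * q) ^+ 2 by ring.
by rewrite gerBl sqr_ge0.
Qed.

(* Indices start at 0, so [n] here is the paper's [n - 1]. *)
Theorem mainTheorem2 (R : realType) (H : completeNormedModType R[i])
  (ip : {dot H for Num.conj}) (ip_norm : induces_norm ip)
  (D : set H) (D_dict : dictionary D)
  (M : R) (M_gt0 : 0 < M) (f : H) (f_class : l1_class D M f)
  (c : nat -> R[i]) (u : nat -> H) (f_repr : l1_representation D M f c u)
  (t : nat -> R) (t_range : forall k, 0 < t k <= 1)
  (psi : nat -> H) (psi_real : WPreOGA_realization ip D t f psi)
  (n : nat) (f_neq0 : forall k, (k < n)%N -> remainder ip f psi k != 0) :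
  rnorm (remainder ip f psi n) <=
    M * (1 + \sum_(k < n) (t k / residual_radius ip psi u k) ^+ 2) `^ (- 2^-1).
Proof.
clear f_class f_neq0.
pose w n := 1 + \sum_(k < n) (t k / residual_radius ip psi u k) ^+ 2.
have w_gt0 m : 0 < w m.
  by rewrite ltr_pwDl// sumr_ge0// => k _; exact: sqr_ge0.
have [Du _ _] := f_repr.
suff bound m : rnorm (remainder ip f psi m) ^+ 2 * w m <= M ^+ 2.
  rewrite -/(w n) powRN powR12_sqrt ?(ltW (w_gt0 n))// ler_pdivlMr ?sqrtr_gt0//.
  rewrite -ler_sqr ?nnegrE ?(ltW M_gt0) ?mulr_ge0 ?rnorm_ge0 ?sqrtr_ge0//.
  by rewrite exprMn sqr_sqrtr ?(ltW (w_gt0 n)).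
elim: m => [|m IH].
  (* The empty sum gives weight 1, so the base case is [rnorm f <= M]. *)
  rewrite /w big_ord0 addr0 mulr1 ler_sqr ?nnegrE ?rnorm_ge0 ?(ltW M_gt0)//.
  exact: (l1_representation_rnorm_le ip_norm f_repr).
have [t0 _] := andP (t_range m).
have [_ psi_m] := psi_real m.
rewrite /w big_ord_recr/= addrA -/(w m) -/(remainder ip f psi m.+1).
have s0 := le_trans (rnorm_ge0 _) (gs_vector_ip_le_sup ip_norm psi f m (Du 0%N)).
apply: greedy_recursion_step (rnorm_remainder_le ip_norm psi D_dict f_repr m)
  _ _ _ _ IH => //; rewrite ?sqr_ge0 ?(ltW t0) ?(ltW (w_gt0 m))//.
  (* The drop in squared norm is at least [(t m * s) ^+ 2], [s] being the supremum, by the selection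
     rule. *)
  rewrite (rnorm_remainderS ip_norm) lerD2l lerN2.
  by rewrite ler_sqr ?nnegrE ?rnorm_ge0// mulr_ge0 ?(ltW t0).
exact: le_trans (rnorm_ge0 _) (le_residual_radius ip_norm psi D_dict f_repr m 0%N).
Qed.
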